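(* Let $\mathcal{A}$ be an infinite set with a height function, let $\mathcal{A}(N)$ be the finite set of its elements of height at most $N$, and assume $\log|\mathcal{A}(N)|\asymp\log N$. For each prime $p$ let $f_p:\mathcal{A}\to\{-1,0,1\}$. Suppose there exist $\xi>0$ and multiplicative functions $\eta_+,\eta_-$ with values in $[0,1]$ such that for every pair of coprime positive squarefree integers $q_-,q_+$ with $q_-q_+\le N^{\xi/2}$, $$\frac{1}{|\mathcal{A}(N)|}\left|\left\{x\in\mathcal{A}(N): p\mid q_-\Rightarrow f_p(x)=-1,\ p\mid q_+\Rightarrow f_p(x)=1\right\}\right|=\eta_-(q_-)\eta_+(q_+)+O(N^{-\xi}),$$ and there are constants $c_+,c_-,C>0$ and $M_+,M_-$ such that, uniformly for all $N\ge2$: $\eta_\pm(p)\ll1/p$; $\sum_{p\le N}\eta_\pm(p)=c_\pm\log\log N+M_\pm+O(1/\log N)$; and $\max_{x\in\mathcal{A}(N)}\prod_{p:\,f_p(x)\ne0}p\ll N^C$. Then for every $A_0>0$ there exists $\delta(A_0)>0$ such that $$\left|\left\{x\in\mathcal{A}(N):\sum_pf_p(x)\ge A_0\log\log N\right\}\right|\gg_{A_0}|\mathcal{A}(N)|(\log N)^{-\delta(A_0)}$$ for all $N\ge2$.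
   Formalization: The lower bound is proved for all N at least some N_0 depending on A_0 and the data, not for all N ≥ 2; for small N the literal claim fails, since no element of A(N) need have sum of f_p(x) as large as A_0 log log N. *)

(* Defs.v *)
From mathcomp Require Import all_boot all_order all_algebra.
From mathcomp Require Import all_classical all_reals all_analysis.
Set Implicit Arguments. Unset Strict Implicit. Unset Printing Implicit Defensive.
Import Order.TTheory GRing.Theory Num.Theory.
Local Open Scope ring_scope.

Definition squarefree (q : nat) : Prop :=
  (0 < q)%N /\ forall d : nat, (1 < d)%N -> ~ (d * d %| q)%N.

Definition mult01 {R : realType} (eta : nat -> R) : Prop :=
  eta 1%N = 1 /\
  (forall m n : nat, coprime m n -> eta (m * n)%N = eta m * eta n) /\
  (forall n : nat, 0 <= eta n <= 1).

Definition psum {R : realType} (g : nat -> R) (N : R) : R :=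
  \sum_(p < (Num.truncn N).+1 | prime p) g p.

Definition fpartial {R : realType} {A : Type} (f : nat -> A -> int) (x : A)
  (n : nat) : R :=
  \sum_(p < n | prime p) (f p x)%:~R.

(* "\sum_p f_p(x) >= t": the (eventually constant, since f_p(x) has finite
   support under the hypotheses) partial sums over primes are eventually >= t *)
Definition fsum_ge {R : realType} {A : Type} (f : nat -> A -> int) (x : A)
  (t : R) : Prop :=
  exists n0 : nat, forall n : nat, (n0 <= n)%N -> t <= fpartial f x n.

Definition count_sieve {A : Type} (f : nat -> A -> int) (s : seq A)
  (qm qp : nat) : nat :=
  count (fun x => all (fun p => f p x == -1) (primes qm)
               && all (fun p => f p x == 1) (primes qp)) s.

(* Main.v *)
Require Import Defs.
From mathcomp Require Import all_boot all_order all_algebra.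
From mathcomp Require Import all_classical all_reals all_analysis.
From mathcomp Require Import ring lra zify.
Set Implicit Arguments. Unset Strict Implicit. Unset Printing Implicit Defensive.
Import Order.TTheory GRing.Theory Num.Theory.
Local Open Scope ring_scope.

(* Write L = ln ln N and let x be uniform in A(N).  Choose about A1 * L disjoint
   blocks of primes (exp (exp u), exp (exp (u + a))] with u <= L / 2, so that a
   product of two transversals of the blocks is a small power of N, and let
   X = prod over the blocks of #{p in the block : f_p = 1} and
   M = #{p <= N^(xi/4) : f_p = -1}.  Equidistribution gives
   E X ~ prod S_i, E (X M) <= prod S_i * sum eta_-(p), and
   E X^2 <= prod S_i (1 + S_i), where S_i, the sum of eta_+ over the i-th block,
   is bounded above and below by positive constants.  Hence X > 0 and
   M < 4 c_- L + O(1) simultaneously with probability at least exp (- delta L).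
   On that event the sum of the f_p over p <= N^(xi/4) is at least
   (A1 - 4 c_-) L - O(1), and by the bound on the support only O(1) primes
   beyond N^(xi/4) have f_p <> 0. *)

(** * Products of distinct primes *)

Lemma prod_primes_gt0 (r : seq nat) :
  all prime r -> (0 < \prod_(p <- r) p)%N.
Proof.
elim: r => [|q r IH] /=; first by rewrite big_nil.
by case/andP=> /prime_gt0 q0 /IH r0; rewrite big_cons muln_gt0 q0.
Qed.

Lemma prime_dvd_prod_primes (r : seq nat) (p : nat) :
  all prime r -> prime p -> (p %| \prod_(q <- r) q)%N = (p \in r).
Proof.
move=> rP pP; elim: r rP => [|q r IH] /=; first by rewrite big_nil Euclid_dvd1.
case/andP=> qP /IH IHr; rewrite big_cons Euclid_dvdM // IHr inE.
by rewrite dvdn_prime2.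
Qed.

Lemma primes_prod_primes (r : seq nat) :
  all prime r -> primes (\prod_(p <- r) p)%N =i r.
Proof.
move=> rP p; rewrite mem_primes prod_primes_gt0 //=.
have [pP|pN] := boolP (prime p); first by rewrite prime_dvd_prod_primes.
by apply/esym/negP => /(allP rP); apply/negP.
Qed.

Lemma coprime_prod_primes (r : seq nat) (p : nat) :
  all prime r -> prime p -> p \notin r -> coprime p (\prod_(q <- r) q)%N.
Proof. by move=> rP pP pr; rewrite prime_coprime // prime_dvd_prod_primes. Qed.

(** If d * d divides the product, so does p * p for a prime p dividing d. Cancelling one p leaves p
    dividing a product of primes that no longer contains it, as the list has no repetition. *)
Lemma squarefree_prod_primes (r : seq nat) :
  uniq r -> all prime r -> squarefree (\prod_(p <- r) p)%N.
Proof.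
move=> ur rP; split; first exact: prod_primes_gt0.
move=> d d1 ddv; have pP := pdiv_prime d1; set p := pdiv d in pP.
have ppdv : (p * p %| \prod_(q <- r) q)%N.
  by apply: dvdn_trans ddv; apply: dvdn_mul; apply: pdiv_dvd.
have pr : p \in r.
  by rewrite -prime_dvd_prod_primes //; apply: dvdn_trans ppdv; apply: dvdn_mulr.
move: ppdv; rewrite (big_rem p pr) /= dvdn_pmul2l ?prime_gt0 //.
rewrite prime_dvd_prod_primes //; last first.
  by apply/allP => q /mem_rem /(allP rP).
by rewrite mem_rem_uniqF.
Qed.

Lemma mult01_prod_primes {R : realType} (eta : nat -> R) (r : seq nat) :
  mult01 eta -> uniq r -> all prime r ->
  eta (\prod_(p <- r) p)%N = \prod_(p <- r) eta p.
Proof.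
case=> eta1 [etaM _]; elim: r => [|p r IH] /=; first by rewrite !big_nil.
case/andP=> pr ur /andP[pP rP].
by rewrite !big_cons etaM ?IH // coprime_prod_primes.
Qed.

Lemma prod_leq_exp (r : seq nat) (n : nat) :
  all (fun p => (p <= n)%N) r -> (\prod_(p <- r) p <= n ^ size r)%N.
Proof.
elim: r => [|p r IH] /=; first by rewrite big_nil.
by case/andP=> pn /IH rn; rewrite big_cons expnS leq_mul.
Qed.

(** * The second moment method over transversals of the blocks *)

(* Pointwise, 1_G >= 2 l X (1 - M / m) - (l X)^2 for every l >= 0; the choice
   l = H / (2 W) turns this into the claim. *)
Lemma second_moment_count {R : realType} (A : Type) (s : seq A) (X M : A -> R)
  (m H W : R) :
  (forall x, 0 <= X x) -> (forall x, 0 <= M x) -> 0 < m -> 0 < H -> 0 < W ->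
  (size s)%:R * H / 2 <= \sum_(x <- s) X x * (1 - M x / m) ->
  \sum_(x <- s) X x ^+ 2 <= (size s)%:R * W ->
  (size s)%:R * (H ^+ 2 / (4 * W)) <=
    (count (fun x => (0 < X x) && (M x < m)) s)%:R.
Proof.
move=> X0 M0 m0 H0 W0 EX EXX.
set l := H / (2 * W).
have l0 : 0 < l by rewrite divr_gt0 // mulr_gt0.
have pw x : 2 * l * (X x * (1 - M x / m)) - l ^+ 2 * X x ^+ 2
    <= ((0 < X x) && (M x < m))%:R.
  have Mm0 : 0 <= M x / m by rewrite divr_ge0 // ltW.
  have := X0 x; rewrite le_eqVlt => /predU1P[<-|Xx].
    by rewrite ltxx /=; lra.
  rewrite Xx /=; case: ltP => Mm /=.
    have lX : 0 <= l * X x * (M x / m) by apply: mulr_ge0 => //; apply: mulr_ge0; apply: ltW.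
    have := sqr_ge0 (l * X x - 1); rewrite sqrrB1 exprMn; nra.
  have M1 : 1 <= M x / m by rewrite ler_pdivlMr // mul1r.
  have lX : 0 <= l * X x * (M x / m - 1) by apply: mulr_ge0; rewrite ?subr_ge0 //; apply: mulr_ge0; apply: ltW.
  have := sqr_ge0 (l * X x); nra.
rewrite -sum1_count natr_sum big_mkcond /=.
have -> : \sum_(x <- s) (if (0 < X x) && (M x < m) then 1 else 0) =
          \sum_(x <- s) ((0 < X x) && (M x < m))%:R :> R.
  by apply: eq_bigr => x _; case: ifP.
apply: le_trans (ler_sum _ (fun x _ => pw x)).
rewrite sumrB -!mulr_sumr.
have -> : (size s)%:R * (H ^+ 2 / (4 * W)) =
   2 * l * ((size s)%:R * H / 2) - l ^+ 2 * ((size s)%:R * W).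
  by rewrite /l; field; lra.
by apply: lerB; apply: ler_wpM2l => //; [lra | exact: sqr_ge0].
Qed.

Lemma card_family_le (k n : nat) (P : 'I_k -> pred 'I_n) :
  (#|(family P : simpl_pred {ffun 'I_k -> 'I_n})| <= n ^ k)%N.
Proof. by apply: leq_trans (max_card _) _; rewrite card_ffun !card_ord. Qed.

Lemma exchange_mulr_sum {R : pzRingType} (A : Type) (J : finType) (s : seq A)
  (Q : pred J) (F : A -> R) (G : A -> J -> R) :
  \sum_(x <- s) F x * (\sum_(j | Q j) G x j) =
  \sum_(j | Q j) \sum_(x <- s) F x * G x j.
Proof.
by rewrite [RHS]exchange_big; apply: eq_bigr => x _; rewrite mulr_sumr.
Qed.

(** Expanding X into a sum over transversals reduces every moment to the three correlation bounds,
    whose errors [eps] add up over at most [n ^ k] transversals, times [Z] or [n ^ k] again. For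
    fixed t, summing [(u i == t i) + eta (u i)] over the i-th block gives at most 1 + D, whence the
    factor [D * (1 + D)] per block in the second moment. *)
Lemma transversal_count {R : realType} (A : Type) (s : seq A) (k n Z : nat)
  (P : 'I_k -> pred 'I_n) (a b : A -> nat -> R) (eta etam : nat -> R)
  (eps sig D m : R) :
  (forall x p, 0 <= a x p) -> (forall x p, 0 <= b x p) ->
  (forall p, 0 <= eta p) -> 0 <= eps -> 0 < sig -> 1 <= m -> (0 < Z)%N ->
  (forall i, sig <= \sum_(p < n | P i p) eta p <= D) ->
  (forall t : {ffun 'I_k -> 'I_n}, t \in family P ->
    (size s)%:R * (\prod_i eta (t i) - eps)
      <= \sum_(x <- s) \prod_i a x (t i)) ->
  (forall (t : {ffun 'I_k -> 'I_n}) (p : 'I_Z), t \in family P -> prime p ->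
    \sum_(x <- s) (\prod_i a x (t i)) * b x p
      <= (size s)%:R * ((\prod_i eta (t i)) * etam p + eps)) ->
  (forall t u : {ffun 'I_k -> 'I_n}, t \in family P -> u \in family P ->
    \sum_(x <- s) (\prod_i a x (t i)) * (\prod_i a x (u i))
      <= (size s)%:R * (\prod_i (eta (t i) * ((u i == t i)%:R + eta (u i)))
                        + eps)) ->
  \sum_(p < Z | prime p) etam p <= m / 4 ->
  (n ^ k * Z)%N%:R * eps <= sig ^+ k / 8 ->
  (n ^ k * n ^ k)%N%:R * eps <= 1 ->
  (size s)%:R * ((sig ^+ k) ^+ 2 / (4 * ((D * (1 + D)) ^+ k + 1))) <=
   (count (fun x => (0 < \prod_i \sum_(p < n | P i p) a x p :> R) &&
                    (\sum_(p < Z | prime p) b x p < m)) s)%:R.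
Proof.
move=> a0 b0 eta0 eps0 sig0 m1 Z0 S_bd hX hXM hXX hm he1 he2.
set H := \prod_i \sum_(p < n | P i p) eta p.
set c := #|(family P : simpl_pred {ffun 'I_k -> 'I_n})|.
have m0 : 0 < m by lra.
(* The sign of D is known only when some block exists; for k = 0 the powers are 1. *)
have D0 : k != 0%N -> 0 < D.
  by case: (k) P S_bd {hX hXM hXX H c} => // k' P S_bd _; have := S_bd ord0; lra.
have HE : H = \sum_(t in family P) \prod_i eta (t i).
  by rewrite /H bigA_distr_big_dep.
have XE x : \prod_i \sum_(p < n | P i p) a x p =
    \sum_(t in family P) \prod_i a x (t i) :> R.
  by rewrite bigA_distr_big_dep.
have sigH : sig ^+ k <= H.
  rewrite -[k in sig ^+ k]card_ord -prodr_const; apply: ler_prod => i _.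
  by rewrite (ltW sig0) /=; have /andP[] := S_bd i.
have H0 : 0 < H by apply: lt_le_trans sigH; rewrite exprn_gt0.
have ck : c%:R <= (n ^ k)%N%:R :> R by rewrite ler_nat card_family_le.
have DD0 : 0 <= (D * (1 + D)) ^+ k.
  have [->|/D0 ?] := eqVneq k 0%N; first by rewrite expr0.
  by rewrite exprn_ge0 // mulr_ge0 //; lra.
apply: second_moment_count => //.
- by move=> x; apply: prodr_ge0 => i _; apply: sumr_ge0.
- by move=> x; apply: sumr_ge0.
- by rewrite exprn_gt0.
- by lra.
- have EX : (size s)%:R * (H - c%:R * eps) <=
      \sum_(x <- s) \sum_(t in family P) \prod_i a x (t i).
    rewrite exchange_big /= HE.
    have -> : c%:R * eps = \sum_(t in family P) eps.
      by rewrite sumr_const mulr_natl.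
    rewrite -sumrB mulr_sumr.
    exact: ler_sum.
  have EXM : \sum_(x <- s) (\sum_(t in family P) \prod_i a x (t i)) *
        (\sum_(p < Z | prime p) b x p) <=
      (size s)%:R * (H * (m / 4) + (c * Z)%:R * eps).
    under eq_bigr => x _ do rewrite mulr_suml.
    rewrite exchange_big /=.
    have : forall t, t \in family P -> \sum_(x <- s) (\prod_i a x (t i)) *
        (\sum_(p < Z | prime p) b x p) <=
        (size s)%:R * ((\prod_i eta (t i)) * (m / 4) + Z%:R * eps).
      move=> t tP; rewrite exchange_mulr_sum.
      apply: le_trans (ler_sum _ (fun p pP => hXM t p tP pP)) _.
      rewrite -mulr_sumr ler_wpM2l // big_split /= -mulr_sumr lerD //.
        by rewrite ler_wpM2l // prodr_ge0.
      rewrite sumr_const -[X in X <= _]mulr_natl ler_wpM2r // ler_nat.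
      by apply: leq_trans (max_card _) _; rewrite card_ord.
    move=> /(ler_sum _) /le_trans; apply.
    rewrite -mulr_sumr big_split /= -mulr_suml -HE sumr_const.
    by rewrite natrM -[c%:R * _ * _]mulrA [c%:R * _]mulr_natl.
  have E1 : \sum_(x <- s) (\prod_i \sum_(p < n | P i p) a x p) *
        (1 - (\sum_(p < Z | prime p) b x p) / m) =
      \sum_(x <- s) \sum_(t in family P) \prod_i a x (t i) -
      (\sum_(x <- s) (\sum_(t in family P) \prod_i a x (t i)) *
        (\sum_(p < Z | prime p) b x p)) / m :> R.
    rewrite mulr_suml -sumrB; apply: eq_bigr => x _.
    by rewrite XE mulrBr mulr1 mulrA.
  rewrite E1.
  have cZ : (c * Z)%:R * eps <= sig ^+ k / 8.
    by apply: le_trans he1; rewrite ler_wpM2r // ler_nat leq_mul // card_family_le.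
  have c1 : c%:R * eps <= sig ^+ k / 8.
    by apply: le_trans cZ; rewrite ler_wpM2r // ler_nat leq_pmulr.
  have EXM' : (\sum_(x <- s) (\sum_(t in family P) \prod_i a x (t i)) *
        (\sum_(p < Z | prime p) b x p)) / m <=
      (size s)%:R * (H / 4 + sig ^+ k / 8).
    rewrite ler_pdivrMr //; apply: le_trans EXM _.
    rewrite -mulrA ler_wpM2l //.
    have : sig ^+ k / 8 * 1 <= sig ^+ k / 8 * m.
      by rewrite ler_wpM2l // divr_ge0 // exprn_ge0 // ltW.
    lra.
  (* What remains is at least (H - sig^k / 8) - (H / 4 + sig^k / 8), which is at least sig^k / 2
     because H >= sig^k. *)
  apply: le_trans (lerB EX EXM'); rewrite -mulrA -mulrBr ler_wpM2l //.
  lra.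
- have -> : \sum_(x <- s) (\prod_i \sum_(p < n | P i p) a x p) ^+ 2 =
      \sum_(t in family P) \sum_(u in family P)
       \sum_(x <- s) (\prod_i a x (t i)) * (\prod_i a x (u i)) :> R.
    under eq_bigr => x _ do rewrite expr2 XE mulr_suml.
    rewrite exchange_big /=; apply: eq_bigr => t _.
    by rewrite exchange_mulr_sum.
  have step t : t \in family P -> \sum_(u in family P)
      \sum_(x <- s) (\prod_i a x (t i)) * (\prod_i a x (u i)) <=
      (size s)%:R * (\prod_i (eta (t i) * (1 + D)) + c%:R * eps).
    move=> tP; apply: le_trans (ler_sum _ (fun u uP => hXX t u tP uP)) _.
    rewrite -mulr_sumr ler_wpM2l // big_split /= sumr_const -/c [c%:R * _]mulr_natl lerD //.
    rewrite -(bigA_distr_big_dep P (fun i p => eta (t i) * ((p == t i)%:R + eta p))) /=.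
    apply: ler_prod => i _; rewrite -mulr_sumr; apply/andP; split.
      by rewrite mulr_ge0 // sumr_ge0 // => p _; rewrite addr_ge0.
    rewrite ler_wpM2l // big_split /=; apply: lerD; last by have /andP[] := S_bd i.
    have tPi : P i (t i) by move/familyP: tP => /(_ i).
    rewrite (bigD1 (t i)) //= eqxx big1 ?addr0 // => p /andP[_ /negbTE].
    by move=> ->.
  apply: le_trans (ler_sum _ step) _.
  rewrite -mulr_sumr ler_wpM2l // big_split /=; apply: lerD.
    rewrite -(bigA_distr_big_dep P (fun i p => eta p * (1 + D))) /=.
    have -> : (D * (1 + D)) ^+ k = \prod_(i < k) (D * (1 + D)).
      by rewrite prodr_const card_ord.
    apply: ler_prod => i _.
    have iD : 0 < D by apply: D0; case: (k) i => // -[].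
    rewrite -mulr_suml mulr_ge0 ?sumr_ge0 //=; last by lra.
    by rewrite ler_wpM2r //; [lra | have /andP[] := S_bd i].
  rewrite sumr_const -/c -[X in X <= _]mulr_natl mulrA -natrM; apply: le_trans he2.
  by rewrite ler_wpM2r // ler_nat leq_mul // card_family_le.
Qed.

(** * Correlations of the indicators of f_p = 1 and f_p = -1 from equidistribution *)

Lemma prod_indicators {R : comNzRingType} (c : nat -> bool) (r : seq nat) :
  \prod_(p <- r) (c p)%:R = (all c r)%:R :> R.
Proof.
elim: r => [|p r IH] /=; first by rewrite big_nil.
by rewrite big_cons IH -natrM mulnb.
Qed.

(** Equidistribution at q_- = prod [rm], q_+ = prod [rp], restated without division by the size of
    s, so that it can be summed over prime lists. *)
Lemma sieve_sum {R : realType} (A : Type) (s : seq A) (f : nat -> A -> int)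
  (eta_m eta_p : nat -> R) (eps Q : R) (rm rp : seq nat) :
  mult01 eta_m -> mult01 eta_p ->
  (forall qm qp : nat, squarefree qm -> squarefree qp -> coprime qm qp ->
     (qm * qp)%N%:R <= Q ->
     `| (count_sieve f s qm qp)%:R / (size s)%:R - eta_m qm * eta_p qp | <= eps) ->
  uniq (rm ++ rp) -> all prime (rm ++ rp) ->
  (\prod_(p <- rm ++ rp) p)%N%:R <= Q ->
  `| \sum_(x <- s) (\prod_(p <- rm) (f p x == -1)%:R) *
                   (\prod_(p <- rp) (f p x == 1)%:R)
     - (size s)%:R * ((\prod_(p <- rm) eta_m p) * \prod_(p <- rp) eta_p p) |
    <= (size s)%:R * eps.
Proof.
move=> em ep equi; rewrite cat_uniq all_cat => /and3P[um hn up] /andP[pm pp].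
rewrite big_cat /= => leQ.
have cop : coprime (\prod_(p <- rm) p)%N (\prod_(p <- rp) p)%N.
  elim: (rm) pm hn => [|p r IH]; first by rewrite big_nil coprime1n.
  move=> /= /andP[pP rP] hn; rewrite big_cons coprimeMl IH //; last first.
    by apply: contra hn => /hasP[q qr qp]; apply/hasP; exists q; rewrite // inE qp orbT.
  rewrite coprime_prod_primes //; apply: contra hn => prp.
  by apply/hasP; exists p; rewrite // inE eqxx.
have := equi _ _ (squarefree_prod_primes um pm) (squarefree_prod_primes up pp) cop leQ.
rewrite !mult01_prod_primes //; set e := (X in _ - X); set cs := count_sieve _ _ _ _.
have -> : \sum_(x <- s) (\prod_(p <- rm) (f p x == -1)%:R) *
                   (\prod_(p <- rp) (f p x == 1)%:R) = cs%:R :> R.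
  rewrite /cs /count_sieve -sum1_count natr_sum [RHS]big_mkcond /=.
  apply: eq_bigr => x _; rewrite !prod_indicators -natrM mulnb.
  rewrite (eq_all_r (primes_prod_primes pm)) (eq_all_r (primes_prod_primes pp)).
  by case: ifP.
have [s0|s0] := posnP (size s).
  have -> : cs = 0%N.
    by apply/eqP; rewrite -leqn0 -s0 /cs /count_sieve count_size.
  by rewrite s0 !mul0r subrr normr0.
have sR : 0 < (size s)%:R :> R by rewrite ltr0n.
move=> he.
have -> : cs%:R - (size s)%:R * e = (size s)%:R * (cs%:R / (size s)%:R - e).
  by field; rewrite gt_eqF.
by rewrite normrM ger0_norm ?ler_pM2l // ltW.
Qed.

Lemma sieve_transversal_count {R : realType} (A : Type) (s : seq A)
  (f : nat -> A -> int) (eta_m eta_p : nat -> R) (k n Z : nat)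
  (P : 'I_k -> pred 'I_n) (eps Q sig D m : R) :
  mult01 eta_m -> mult01 eta_p ->
  (forall qm qp : nat, squarefree qm -> squarefree qp -> coprime qm qp ->
     (qm * qp)%N%:R <= Q ->
     `| (count_sieve f s qm qp)%:R / (size s)%:R - eta_m qm * eta_p qp | <= eps) ->
  (forall i p, P i p -> prime p) -> (forall i j p, P i p -> P j p -> i = j) ->
  0 < sig -> 1 <= m -> (0 < n)%N -> (0 < Z)%N -> 0 <= eps ->
  (forall i, sig <= \sum_(p < n | P i p) eta_p p <= D) ->
  \sum_(p < Z | prime p) eta_m p <= m / 4 ->
  (n ^ k * n ^ k)%N%:R <= Q -> (n ^ k * Z)%N%:R <= Q ->
  (n ^ k * Z)%N%:R * eps <= sig ^+ k / 8 ->
  (n ^ k * n ^ k)%N%:R * eps <= 1 ->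
  (size s)%:R * ((sig ^+ k) ^+ 2 / (4 * ((D * (1 + D)) ^+ k + 1))) <=
   (count (fun x => (0 < \prod_i \sum_(p < n | P i p) (f p x == 1)%:R :> R) &&
                    (\sum_(p < Z | prime p) (f p x == -1)%:R < m)) s)%:R.
Proof.
move=> em ep equi Pprime Pdisj sig0 m1 n0 Z0 eps0 S_bd hm Qnn QnZ he1 he2.
have ep0 p : 0 <= eta_p p by case: ep => _ [_ /(_ p)/andP[]].
have em0 p : 0 <= eta_m p by case: em => _ [_ /(_ p)/andP[]].
pose T (t : {ffun 'I_k -> 'I_n}) := [seq val (t i) | i <- index_enum 'I_k].
have Tinj (t : {ffun 'I_k -> 'I_n}) : t \in family P -> injective (fun i => val (t i)).
  move=> /familyP tP i j /val_inj tij; apply: (Pdisj i j (t i)); first exact: tP.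
  by rewrite tij; exact: tP.
have Tuniq t : t \in family P -> uniq (T t).
  by move=> tP; rewrite map_inj_uniq ?index_enum_uniq //; exact: Tinj.
have Tprime t : t \in family P -> all prime (T t).
  move=> /familyP tP; rewrite all_map; apply/allP => i _ /=.
  exact: Pprime (tP i).
have Tsize t : size (T t) = k.
  by rewrite size_map -[RHS](card_ord k) cardE enumT.
have Tle t : (\prod_(p <- T t) p <= n ^ k)%N.
  rewrite -(Tsize t); apply: prod_leq_exp; rewrite all_map; apply/allP => i _ /=.
  exact: ltnW.
have nk0 : (0 < n ^ k)%N by rewrite expn_gt0 n0.
apply: (@transversal_count _ _ s k n Z P (fun x p => (f p x == 1)%:R)
  (fun x p => (f p x == -1)%:R) eta_p eta_m eps) => //.
- move=> t tP.
  have := @sieve_sum _ _ s f _ _ eps Q [::] (T t) em ep equi (Tuniq t tP) (Tprime t tP).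
  have TQ : (\prod_(p <- T t) p)%N%:R <= Q.
    by apply: le_trans QnZ; rewrite ler_nat (leq_trans (Tle t)) // leq_pmulr.
  move=> /(_ TQ).
  rewrite big_nil mul1r big_map.
  have E x : (\prod_(p <- [::]) (f p x == -1)%:R) *
      (\prod_(p <- T t) (f p x == 1)%:R) = \prod_i (f (t i) x == 1)%:R :> R.
    by rewrite big_nil mul1r big_map.
  rewrite (eq_bigr _ (fun x _ => E x)).
  by rewrite ler_norml => /andP[+ _]; rewrite mulrBr; lra.
- move=> t p tP pP.
  (* If p lies on the transversal, the summand vanishes, as f_p cannot be both 1 and -1; otherwise p
     is coprime to the product of the transversal and q_- = p is admissible. *)
  have [pT|pT] := boolP (val p \in T t).
    rewrite big1 => [|x _].
      by apply: mulr_ge0 => //; apply: addr_ge0 => //; apply: mulr_ge0 => //; apply: prodr_ge0.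
    case/mapP: pT => i _ pE; rewrite pE (bigD1 i) //= mulrAC -natrM.
    case: (f _ x =P 1) => [->|_]; last by rewrite mul0n mul0r.
    by rewrite (_ : (1 == -1 :> int) = false) // muln0 mul0r.
  have := @sieve_sum _ _ s f _ _ eps Q [:: val p] (T t) em ep equi.
  rewrite /= pT Tuniq // pP Tprime // => /(_ isT isT).
  have TQ : (val p * \prod_(q <- T t) q)%N%:R <= Q.
    apply: le_trans QnZ; rewrite ler_nat mulnC.
    exact: leq_mul (Tle t) (ltnW (ltn_ord p)).
  rewrite big_cons => /(_ TQ).
  rewrite big_seq1 big_map.
  have E x : (\prod_(q <- [:: val p]) (f q x == -1)%:R) *
      (\prod_(q <- T t) (f q x == 1)%:R) =
      (\prod_i (f (t i) x == 1)%:R) * (f p x == -1)%:R :> R.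
    by rewrite big_seq1 big_map mulrC.
  rewrite (eq_bigr _ (fun x _ => E x)).
  by rewrite ler_norml => /andP[_]; rewrite mulrDr [eta_m p * _]mulrC; lra.
- move=> t u tP uP.
  (* Squares of indicators are idempotent, so only the entries of u differing from those of t are
     kept. By disjointness of the blocks, an entry of u can equal only the entry of t with the same
     index; hence [T t ++ U] has no repetition. *)
  pose U := [seq val (u i) | i <- [seq i <- index_enum 'I_k | u i != t i]].
  have Usub : subseq U (T u) by apply: map_subseq; apply: filter_subseq.
  have dis : ~~ has (mem (T t)) U.
    apply/hasPn => q /mapP[j]; rewrite mem_filter => /andP[jtu _] ->.
    apply: contra jtu => /mapP[i _ /val_inj uj]; rewrite uj.
    move/familyP: tP => tP; move/familyP: uP => uP.
    by rewrite (Pdisj i j (t i) (tP i)) // -uj; apply: uP.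
  have := @sieve_sum _ _ s f _ _ eps Q [::] (T t ++ U) em ep equi.
  rewrite /= cat_uniq Tuniq // dis (subseq_uniq Usub) ?Tuniq // => /(_ isT).
  have Uprime : all prime U.
    by apply/allP => q /(mem_subseq Usub) /(allP (Tprime u uP)).
  rewrite all_cat Tprime //= Uprime => /(_ isT).
  have TQ : ((\prod_(q <- T t) q) * \prod_(q <- U) q)%N%:R <= Q.
    apply: le_trans Qnn; rewrite ler_nat leq_mul //.
    have Un : (\prod_(q <- U) q <= n ^ size U)%N.
      by apply: prod_leq_exp; rewrite all_map; apply/allP => i _ /=; exact: ltnW.
    apply: leq_trans Un _; rewrite leq_pexp2l // -(Tsize u); exact: size_subseq.
  rewrite big_cat /= => /(_ TQ).
  rewrite big_nil mul1r big_cat /= !big_map big_filter.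
  have E x : (\prod_(p <- [::]) (f p x == -1)%:R) *
      (\prod_(p <- T t ++ U) (f p x == 1)%:R) =
      (\prod_i (f (t i) x == 1)%:R) * (\prod_i (f (u i) x == 1)%:R) :> R.
    rewrite big_nil mul1r big_cat /= !big_map big_filter.
    rewrite [X in _ * X = _]big_mkcond -!big_split /=.
    apply: eq_bigr => i _; case: (u i =P t i) => [->|_] /=; last by [].
    by rewrite -natrM mulnb andbb mulr1.
  rewrite (eq_bigr _ (fun x _ => E x)).
  rewrite ler_norml => /andP[_]; rewrite lerBlDl.
  move=> /le_trans; apply; rewrite mulrDr lerD2r ler_wpM2l //.
  (* Where u and t agree, the true factor is 1, at most 1 + eta; elsewhere it is exactly eta. *)
  rewrite [X in _ * X]big_mkcond -big_split /=; apply: ler_prod => i _.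
  rewrite mulr_ge0 //=; last by case: ifP.
  by rewrite ler_wpM2l //; case: eqP => _ /=; have := ep0 (u i); lra.
Qed.

(** * From prime counts to the partial sums of f_p *)

(** A nonzero product forces every block to contain a prime with f_p = 1, and disjointness means
    that no prime serves two blocks. *)
Lemma leq_blocks_count (A : Type) (f : nat -> A -> int) (x : A) (k n n' : nat)
  (P : 'I_k -> pred 'I_n) :
  (forall i p, P i p -> prime p) -> (forall i j p, P i p -> P j p -> i = j) ->
  (n <= n')%N ->
  (0 < \prod_i \sum_(p < n | P i p) (f p x == 1%R))%N ->
  (k <= \sum_(p < n' | prime p) (f p x == 1%R))%N.
Proof.
move=> Pprime Pdisj nn' X0.
have bl i : (1 <= \sum_(p < n | P i p) (f p x == 1%R))%N.
  by move: X0; rewrite (bigD1 i) //= muln_gt0 => /andP[].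
apply: (@leq_trans (\sum_(i < k) \sum_(p < n | P i p) (f p x == 1%R))%N).
  rewrite -[X in (X <= _)%N](card_ord k) -sum1_card.
  by apply: leq_sum => i _; exact: bl.
rewrite (exchange_big_dep (fun p : 'I_n => prime p)) /=; last first.
  by move=> i p _; exact: Pprime.
apply: (@leq_trans (\sum_(p < n | prime p) (f p x == 1%R))%N).
  apply: leq_sum => p _; rewrite sum_nat_const.
  rewrite -[X in (_ <= X)%N]mul1n leq_mul2r; apply/orP; right.
  by apply/card_le1_eqP => i j iP jP; apply: (Pdisj j i p jP iP).
rewrite (big_ord_widen_cond _ (fun p => prime p) (fun p => (f p x == 1%R) : nat) nn').
rewrite big_mkcond [X in (_ <= X)%N]big_mkcond; apply: leq_sum => p _.
by case: (prime p); case: (p < n)%N.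
Qed.

(** The primes with f_p = -1 are counted by [m] below [Z]; from [Z] on they are among the at most
    [B] primes of the support. *)
Lemma fpartial_ge {R : realType} (A : Type) (f : nat -> A -> int) (x : A)
  (n Z : nat) (k m B : R) :
  (forall p, f p x \in [:: -1; 0; 1]) -> (Z <= n)%N ->
  k <= (\sum_(p < n | prime p) (f p x == 1%R))%N%:R ->
  (\sum_(p < Z | prime p) (f p x == (-1)%R))%N%:R <= m ->
  (\sum_(Z <= p < n | prime p && (f p x != 0%R)) 1)%N%:R <= B ->
  k - m - B <= fpartial f x n.
Proof.
move=> fval Zn hk hm hB.
have -> : fpartial f x n = (\sum_(p < n | prime p) (f p x == 1%R))%N%:R -
    (\sum_(p < n | prime p) (f p x == (-1)%R))%N%:R :> R.
  rewrite !natr_sum -sumrB; apply: eq_bigr => p _.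
  have := fval p; rewrite !inE => /or3P[] /eqP -> /=;
    by rewrite ?(subr0, sub0r, mulr1z, mulr0z, subrr, mulrN1z).
have split : (\sum_(p < n | prime p) (f p x == (-1)%R) <=
   \sum_(p < Z | prime p) (f p x == (-1)%R) +
   \sum_(Z <= p < n | prime p && (f p x != 0%R)) 1)%N.
  rewrite -(big_mkord prime (fun p => (f p x == (-1)%R) : nat)).
  rewrite -(big_mkord prime (fun p => (f p x == (-1)%R) : nat)).
  rewrite (@big_cat_nat _ _ _ Z) //= leq_add2l big_mkcond /=.
  rewrite [X in (_ <= X)%N]big_mkcond /=; apply: leq_sum => p _.
  by case: (prime p) => //=; case: eqP => // ->.
by move: split; rewrite -(ler_nat R) natrD; lra.
Qed.

Lemma expn_large_support_le (A : Type) (f : nat -> A -> int) (x : A) (n Z : nat) :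
  (Z <= n)%N ->
  (Z ^ (\sum_(Z <= p < n | prime p && (f p x != 0%R)) 1)
    <= \prod_(p < n | prime p && (f p x != 0%R)) p)%N.
Proof.
move=> Zn; rewrite -(big_mkord (fun p => prime p && (f p x != 0)) id).
rewrite [X in (_ <= X)%N](@big_cat_nat _ _ _ Z) //= -[(Z ^ _)%N]mul1n; apply: leq_mul.
  by apply: prodn_cond_gt0 => p /andP[/prime_gt0].
rewrite [X in (_ <= X)%N]big_nat_cond [in X in (X <= _)%N]big_nat_cond.
rewrite (big_morph _ (expnD Z) (expn0 Z)).
by apply: leq_prod => p /andP[/andP[Zp _] _]; rewrite expn1.
Qed.

(** * Mertens sums over the blocks and size estimates, with N = exp (exp L) *)

(** Subtracting the Mertens estimates at exp (exp v) and exp (exp u) cancels M; each error K / ln is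
    at most |K| exp (- u). *)
Lemma mertens_block {R : realType} (eta : nat -> R) (c M K u v : R) (n : nat) :
  (forall N : R, 2 <= N -> `| psum eta N - c * ln (ln N) - M | <= K / ln N) ->
  0 <= u -> u <= v -> (Num.truncn (expR (expR v)) < n)%N ->
  `| \sum_(p < n | prime p && (Num.truncn (expR (expR u)) < p
                             <= Num.truncn (expR (expR v)))%N) eta p
     - c * (v - u) | <= 2 * `|K| * expR (- u).
Proof.
move=> mert u0 uv vn.
have Y2 (w : R) : 0 <= w -> 2 <= expR (expR w) :> R.
  move=> w0; have := expR_ge1Dx (expR w); have := expR_ge1Dx w; lra.
have mertY w : u <= w ->
    `| psum eta (expR (expR w)) - c * w - M | <= `|K| * expR (- u).
  move=> uw; have := mert _ (Y2 w (le_trans u0 uw)); rewrite !expRK => /le_trans; apply.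
  rewrite -expRN; apply: (@le_trans _ _ (`|K| * expR (- w))).
    by rewrite ler_wpM2r ?expR_ge0 // ler_norm.
  by rewrite ler_wpM2l // ler_expR lerN2.
have trle : (Num.truncn (expR (expR u)) <= Num.truncn (expR (expR v)))%N.
  by apply: le_truncn; rewrite !ler_expR.
have -> : \sum_(p < n | prime p && (Num.truncn (expR (expR u)) < p
                       <= Num.truncn (expR (expR v)))%N) eta p =
    psum eta (expR (expR v)) - psum eta (expR (expR u)).
  rewrite /psum; move: trle vn.
  set a := Num.truncn _; set b := Num.truncn _ => ab bn.
  rewrite -(big_mkord (fun p => prime p && (a < p <= b)%N) eta).
  rewrite -(big_mkord prime eta) -(big_mkord prime eta).
  rewrite [X in _ = X - _](@big_cat_nat _ _ _ a.+1) //= [RHS]addrAC subrr add0r.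
  rewrite [LHS](@big_cat_nat _ _ _ b.+1) //=.
  rewrite [X in X + _ = _](@big_cat_nat _ _ _ a.+1) //=.
  rewrite [X in X + _ + _ = _]big_nat_cond big_pred0 ?add0r; last first.
    by move=> p; case: (prime p) => /=; rewrite ?andbF //; lia.
  rewrite [X in _ + X = _]big_nat_cond [X in _ + X = _]big_pred0 ?addr0; last first.
    by move=> p; case: (prime p) => /=; rewrite ?andbF //; lia.
  by rewrite big_nat_cond [RHS]big_nat_cond; apply: eq_bigl => p; case: (prime p); rewrite /= ?andbF //; lia.
have := mertY u (lexx u); have := mertY v uv.
rewrite !ler_norml => /andP[h1 h2] /andP[h3 h4]; apply/andP; lra.
Qed.

Lemma sqr_le_expR {R : realType} (x : R) : 0 <= x -> x ^+ 2 / 4 <= expR x.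
Proof.
move=> x0; have -> : x = x / 2 + x / 2 by lra.
rewrite expRD; have := expR_ge1Dx (x / 2); nra.
Qed.

Lemma truncnS_le_expR {R : realType} (x : R) :
  0 <= x -> (Num.truncn (expR x)).+1%:R <= expR (x + 1).
Proof.
move=> x0; rewrite -natr1 expRD.
have := expR_ge1Dx x; have := expR_ge1Dx (1 : R).
have : (Num.truncn (expR x))%:R <= expR x by rewrite truncn_le expR_ge0.
nra.
Qed.

Lemma exponent_le_of_expn_le {R : realType} (Z b : nat) (w v : R) :
  expR w <= Z%:R -> (Z ^ b)%N%:R <= expR v -> b%:R * w <= v.
Proof.
move=> wZ; rewrite natrX => Zv; rewrite -ler_expR mulrC expRM_natr.
by apply: le_trans Zv; rewrite lerXn2r ?nnegrE ?expR_ge0.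
Qed.

Lemma sub_in_count (A : eqType) (s : seq A) (P Q : pred A) :
  {in s, subpred P Q} -> (count P s <= count Q s)%N.
Proof.
elim: s => [//|x s IH] sPQ /=.
apply: leq_add; last by apply: IH => y ys; apply: sPQ; rewrite inE ys orbT.
by have := sPQ x (mem_head x s); case: (P x) => // ->.
Qed.

(** This is n^k <= N^(xi/8). With h = exp (L / 2) one has n <= exp (2 h), and h >= L^2 / 16 gives 16
    k <= xi h, so 2 h k <= (xi / 8) h^2. *)
Lemma block_bound_pow_le {R : realType} (xi A2 L v : R) (k : nat) :
  0 < xi -> 0 <= L -> 256 * A2 <= xi * L -> k%:R <= A2 * L -> v <= L / 2 ->
  ((Num.truncn (expR (expR v))).+1 ^ k)%N%:R <= expR (xi / 8 * expR L).
Proof.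
move=> xi0 L0 xiL kL vL.
set h := expR (L / 2).
have h2 : h * h = expR L by rewrite -expRD; congr expR; lra.
have h0 : 0 <= h by exact: expR_ge0.
have h1 : 1 <= h by have := expR_ge1Dx (L / 2); rewrite -/h; clear -L0; lra.
have hL : (L / 2) ^+ 2 / 4 <= h by apply: sqr_le_expR; lra.
have vh : expR v <= h by rewrite ler_expR.
rewrite natrX; apply: (@le_trans _ _ (expR (2 * h) ^+ k)).
  rewrite lerXn2r ?nnegrE ?expR_ge0 //.
  apply: le_trans (truncnS_le_expR (expR_ge0 v)) _; rewrite ler_expR.
  by clear -vh h1; lra.
rewrite -expRM_natr ler_expR -h2.
have xih : xi * ((L / 2) ^+ 2 / 4) <= xi * h by rewrite ler_wpM2l // ltW.
have bL : 256 * A2 * L <= xi * L * L by rewrite ler_wpM2r.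
have kh : 16 * k%:R <= xi * h by clear -xih bL kL; lra.
have : 16 * k%:R * h <= xi * h * h by rewrite ler_wpM2r.
by move: h k%:R {bL xih hL vh kh h0 h1 h2 kL} => h q H; lra.
Qed.

Lemma truncnS_expR_le {R : realType} (w : R) :
  2 <= w -> (Num.truncn (expR w)).+1%:R <= expR (3 / 2 * w).
Proof.
move=> w2; have w0 : 0 <= w by lra.
by apply: le_trans (truncnS_le_expR w0) _; rewrite ler_expR; lra.
Qed.

(** The total error |K| N^(-xi/2) is a power of N, whereas exp (- sg k) is at worst a power of log
    N; exp L >= L^2 / 4 makes the comparison explicit. *)
Lemma sieve_error_le {R : realType} (xi A2 K sg L : R) (k : nat) :
  0 < xi -> 0 <= sg -> 1 <= L -> 8 * (sg * A2 + 8 * `|K|) <= xi * L ->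
  k%:R <= A2 * L ->
  expR (xi / 2 * expR L) * (`|K| * expR (- (xi * expR L))) <= expR (- sg) ^+ k / 8.
Proof.
move=> xi0 sg0 L1 xiL kL; have L0 : 0 <= L by lra.
have EL := sqr_le_expR L0; move: (expR L) EL => E EL.
have -> : expR (xi / 2 * E) * (`|K| * expR (- (xi * E))) =
    `|K| * expR (- (xi / 2 * E)).
  by rewrite mulrCA -expRD; congr (_ * expR _); lra.
rewrite ler_pdivlMr // -expRM_natr.
have -> : - sg * k%:R = (xi / 2 * E - sg * k%:R) + - (xi / 2 * E) by lra.
rewrite expRD [leLHS]mulrAC ler_wpM2r ?expR_ge0 //.
apply: le_trans (expR_ge1Dx _).
have h1 : sg * k%:R <= sg * (A2 * L) by rewrite ler_wpM2l.
have h2 : xi * (L ^+ 2 / 4) <= xi * E by rewrite ler_wpM2l // ltW.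
have h3 : 8 * (sg * A2 + 8 * `|K|) * L <= xi * L * L by rewrite ler_wpM2r.
have h4 : 8 * `|K| * 1 <= 8 * `|K| * L by rewrite ler_wpM2l // mulr_ge0.
by clear -h1 h2 h3 h4; lra.
Qed.

Lemma mertens_psum_le {R : realType} (eta : nat -> R) (c M K xi L : R) :
  (forall N : R, 2 <= N -> `| psum eta N - c * ln (ln N) - M | <= K / ln N) ->
  0 <= c -> 0 < xi -> 1 <= xi * expR L ->
  psum eta (expR (xi * expR L)) <= c * L + (c * `|ln xi| + `|M| + `|K|).
Proof.
move=> mert c0 xi0 w1; set w := xi * expR L in w1 *.
have ew2 : 2 <= expR w by have := expR_ge1Dx w; clear -w1; lra.
have := mert _ ew2; rewrite expRK ler_norml => /andP[_].
have -> : ln w = ln xi + L by rewrite /w lnM ?posrE ?expR_gt0 // expRK.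
have h1 : K / w <= `|K|.
  rewrite ler_pdivrMr; last by clear -w1; lra.
  have h2 := ler_norm K; have h3 : `|K| * 1 <= `|K| * w by rewrite ler_wpM2l.
  by clear -h2 h3; lra.
have h2 : c * ln xi <= c * `|ln xi| by rewrite ler_wpM2l ?ler_norm.
have h3 := ler_norm M.
by move: (psum _ _) => S h4; clear -h1 h2 h3 h4; lra.
Qed.

(** The condition 4 |K| <= c a u keeps the Mertens error below half of the main term g = c a, so the
    sum lies in [g / 2, 3 g / 2]. The bounds are relaxed to exponentials so that their k-th powers
    become powers of log N. *)
Lemma mertens_block_bounds {R : realType} (eta : nat -> R)
  (c M K a u v : R) (n : nat) :
  (forall N : R, 2 <= N -> `| psum eta N - c * ln (ln N) - M | <= K / ln N) ->
  0 < c * a -> 0 <= a -> 0 <= u -> v = u + a -> 4 * `|K| <= c * a * u ->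
  (Num.truncn (expR (expR v)) < n)%N ->
  expR (- `|ln (c * a / 2)|) <=
   \sum_(p < n | prime p && (Num.truncn (expR (expR u)) < p
                             <= Num.truncn (expR (expR v)))%N) eta p
   <= expR (2 * (c * a)).
Proof.
move=> mert ca0 a0 u0 vE Ku vn.
have uv : u <= v by rewrite vE lerDl.
have := mertens_block mert u0 uv vn; rewrite vE [u + a]addrC addrK.
move: (\sum_(p < n | _) _) => S.
move: (c * a) ca0 Ku => g g0 Ku.
have Ke : 2 * `|K| * expR (- u) <= g / 2.
  rewrite expRN ler_pdivrMr ?expR_gt0 //.
  have h : g * (1 + u) <= g * expR u by rewrite ler_wpM2l ?expR_ge1Dx // ltW.
  by clear -h g0 Ku; lra.
move=> /le_trans /(_ Ke); rewrite ler_norml => /andP[h1 h2].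
apply/andP; split; last first.
  by apply: le_trans (expR_ge1Dx _); clear -h2 g0; lra.
have g20 : 0 < g / 2 by rewrite divr_gt0.
apply: (@le_trans _ _ (g / 2)); last by clear -h1 g0; lra.
rewrite -[leRHS]lnK ?posrE // ler_expR.
by have := ler_norm (- ln (g / 2)); rewrite normrN; clear; lra.
Qed.

(** Here exp L is log N. The numerator contributes 2 sg to the exponent, and 1 + exp g <= exp (g +
    1) contributes 2 g + 1; bounding W + 1 by twice an exponential turns 4 into 8. *)
Lemma density_ge {R : realType} (sg g A2 L : R) (k : nat) :
  0 <= sg -> 0 <= g -> k%:R <= A2 * L ->
  8^-1 * (expR L) `^ (- ((2 * sg + 2 * g + 1) * A2)) <=
  (expR (- sg) ^+ k) ^+ 2 / (4 * ((expR g * (1 + expR g)) ^+ k + 1)).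
Proof.
move=> sg0 g0 kL.
have g1 : 1 <= expR g by have := expR_ge1Dx g; clear -g0; lra.
have P0 : 0 <= expR g * (1 + expR g) by apply: mulr_ge0; clear -g1; lra.
have W1 : (expR g * (1 + expR g)) ^+ k <= expR ((2 * g + 1) * k%:R).
  rewrite expRM_natr lerXn2r ?nnegrE ?expR_ge0 //.
  have -> : 2 * g + 1 = g + (g + 1) by lra.
  rewrite expRD ler_wpM2l ?expR_ge0 // expRD.
  have e2 : expR g * 2 <= expR g * expR 1.
    by rewrite ler_wpM2l ?expR_ge0 //; exact: expR_ge1Dx.
  by clear -g1 e2; lra.
have W0 : 0 <= (expR g * (1 + expR g)) ^+ k by exact: exprn_ge0.
have W2 : 1 <= expR ((2 * g + 1) * k%:R).
  by rewrite -[leLHS]expR0 ler_expR mulr_ge0 //; clear -g0; lra.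
set W := _ ^+ k in W0 W1 *.
rewrite ler_pdivlMr; last by clear -W0; lra.
rewrite -expRM -!expRM_natr.
apply: (@le_trans _ _ (expR (L * - ((2 * sg + 2 * g + 1) * A2)) *
                       expR ((2 * g + 1) * k%:R))).
  rewrite mulrAC [leRHS]mulrC ler_wpM2r ?expR_ge0 //.
  by clear -W1 W2; lra.
rewrite -expRD ler_expR.
have h : (2 * sg + 2 * g + 1) * k%:R <= (2 * sg + 2 * g + 1) * (A2 * L).
  by rewrite ler_wpM2l //; clear -sg0 g0; lra.
by move: k%:R h => q h; clear -h; lra.
Qed.

(** * The pointwise lower bound and the tail of the support *)

Lemma fsum_ge_of_blocks {R : realType} (A : Type) (f : nat -> A -> int) (x : A)
  (k n Z : nat) (P : 'I_k -> pred 'I_n) (m B t : R) :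
  (forall p, f p x \in [:: -1; 0; 1]) ->
  (forall i p, P i p -> prime p) -> (forall i j p, P i p -> P j p -> i = j) ->
  0 < \prod_i \sum_(p < n | P i p) (f p x == 1)%:R :> R ->
  \sum_(p < Z | prime p) (f p x == -1)%:R <= m ->
  (forall n' : nat, (Z <= n')%N ->
     (\sum_(Z <= p < n' | prime p && (f p x != 0%R)) 1)%N%:R <= B) ->
  t <= k%:R - m - B -> fsum_ge f x t.
Proof.
move=> fval Pprime Pdisj X0 Mm hB ht; exists (maxn n Z) => n'.
rewrite geq_max => /andP[nn' Zn']; apply: le_trans ht _.
apply: (@fpartial_ge _ _ _ _ _ Z) => //; last exact: hB.
- rewrite ler_nat; apply: (leq_blocks_count Pprime Pdisj nn').
  rewrite -(ltr_nat R) natr_prod.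
  by rewrite (eq_bigr _ (fun i _ => natr_sum _ _ _ _)).
- by rewrite natr_sum.
Qed.

(** With E = ln N, b support primes beyond Z >= N^xi force N^(xi b) <= K N^C; K <= exp |K| and E >=
    1 absorb the constant. *)
Lemma large_support_le {R : realType} (A : Type) (f : nat -> A -> int) (x : A)
  (n Z : nat) (K C xi E : R) :
  (\prod_(p < n | prime p && (f p x != 0)) p)%N%:R <= K * expR (C * E) ->
  (Z <= n)%N -> 0 < xi -> 1 <= E -> expR (xi * E) <= Z%:R ->
  (\sum_(Z <= p < n | prime p && (f p x != 0%R)) 1)%N%:R <= (`|K| + C) / xi.
Proof.
move=> supp Zn xi0 E1 wZ; have E0 : 0 < E by lra.
have := expn_large_support_le f x Zn.
rewrite -(ler_nat R) => /le_trans /(_ supp).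
set b := (\sum_(_ <= _ < _ | _) _)%N => Zb.
have h1 : K * expR (C * E) <= expR (`|K| + C * E).
  rewrite expRD ler_wpM2r ?expR_ge0 //.
  have h1 := ler_norm K; have h2 := expR_ge1Dx `|K|; clear -h1 h2; lra.
have h2 := exponent_le_of_expn_le wZ (le_trans Zb h1).
have h3 : `|K| * 1 <= `|K| * E by rewrite ler_wpM2l.
rewrite ler_pdivlMr // -(ler_pM2r E0).
by move: b%:R h2 => q h2; clear -h2 h3; lra.
Qed.

(** * Choice of parameters and conclusion *)

Theorem theorem5p3 (R : realType) (A : eqType) (h : A -> R)
  (AN : R -> seq A) (f : nat -> A -> int) (eta_m eta_p : nat -> R)
  (xi c_p c_m C M_p M_m : R)
  (* A is infinite *)
  (Ainf : forall s : seq A, exists x : A, x \notin s)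
  (* A(N) = the finite set of elements of height at most N *)
  (ANuniq : forall N : R, uniq (AN N))
  (ANmem : forall (N : R) (x : A), (x \in AN N) = (h x <= N))
  (* log |A(N)| asymp log N *)
  (Agrowth : exists c1 c2 N1 : R, 0 < c1 /\ 0 < c2 /\
     forall N : R, N1 <= N ->
       c1 * ln N <= ln (size (AN N))%:R <= c2 * ln N)
  (* f_p takes values in {-1,0,1} *)
  (fval : forall (p : nat) (x : A), f p x \in [:: -1; 0; 1])
  (xipos : 0 < xi)
  (eta_m_mult : mult01 eta_m) (eta_p_mult : mult01 eta_p)
  (* equidistribution *)
  (equi : exists K : R, forall N : R, 2 <= N ->
     forall qm qp : nat, squarefree qm -> squarefree qp -> coprime qm qp ->
       ((qm * qp)%N%:R <= N `^ (xi / 2)) ->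
       `| (count_sieve f (AN N) qm qp)%:R / (size (AN N))%:R
          - eta_m qm * eta_p qp | <= K * N `^ (- xi))
  (cppos : 0 < c_p) (cmpos : 0 < c_m) (Cpos : 0 < C)
  (eta_p_small : exists K : R, forall p : nat, prime p -> eta_p p <= K / p%:R)
  (eta_m_small : exists K : R, forall p : nat, prime p -> eta_m p <= K / p%:R)
  (eta_p_mertens : exists K : R, forall N : R, 2 <= N ->
     `| psum eta_p N - c_p * ln (ln N) - M_p | <= K / ln N)
  (eta_m_mertens : exists K : R, forall N : R, 2 <= N ->
     `| psum eta_m N - c_m * ln (ln N) - M_m | <= K / ln N)
  (* max_{x in A(N)} prod_{p : f_p(x) <> 0} p << N^C *)
  (suppbound : exists K : R, forall N : R, 2 <= N ->
     forall x : A, x \in AN N ->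
       forall n : nat, (\prod_(p < n | prime p && (f p x != 0)) p)%N%:R
                       <= K * N `^ C) :
  forall A0 : R, 0 < A0 ->
    exists delta : R, 0 < delta /\
    exists (c N0 : R), 0 < c /\
      forall N : R, N0 <= N -> 2 <= N ->
        c * (size (AN N))%:R * (ln N) `^ (- delta)
          <= (count (fun x => `[< fsum_ge f x (A0 * ln (ln N)) >]) (AN N))%:R.
Proof.
move=> A0 A0_gt0.
have {equi}[K1 equi] := equi.
have {eta_m_mertens}[K2 mert_m] := eta_m_mertens.
have {eta_p_mertens}[K3 mert_p] := eta_p_mertens.
have {suppbound}[K4 supp] := suppbound.
(* The term 4 c_m pays for M, and the extra 1 provides a spare L to absorb c0 + B. *)
pose A1 := A0 + 4 * c_m + 1.
have A1_gt0 : 0 < A1 by rewrite /A1; clear -A0_gt0 cmpos; lra.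
pose A2 := A1 + 1.
have A2_gt0 : 0 < A2 by rewrite /A2; clear -A1_gt0; lra.
(* At most A2 * L blocks of length a then cover at most L / 4 on the ln ln scale. *)
pose a := (4 * A2)^-1.
have a_gt0 : 0 < a by rewrite invr_gt0 mulr_gt0.
pose ca := c_p * a.
have ca_gt0 : 0 < ca by rewrite mulr_gt0.
(* Starting the blocks here makes the Mertens error at most half of the main term in each of
   them. *)
pose u0 := 4 * `|K3| / ca.
have u0_ge0 : 0 <= u0 by rewrite divr_ge0 ?mulr_ge0 // ltW.
pose sg := `|ln (ca / 2)|.
have sg_ge0 : 0 <= sg by exact: normr_ge0.
pose B := (`|K4| + C) / (xi / 4).
pose c0 := 4 * (c_m * `|ln (xi / 4)| + `|M_m| + `|K2| + 1).
pose b1 := 256 * A2.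
pose b2 := 8 * (sg * A2 + 8 * `|K1|).
have xi4_gt0 : 0 < xi / 4 by rewrite divr_gt0.
have b1_ge0 : 0 <= b1 by rewrite mulr_ge0 // ltW.
have b2_ge0 : 0 <= b2.
  by apply: mulr_ge0 => //; apply: addr_ge0; apply: mulr_ge0 => //; exact: ltW.
have c0_ge0 : 0 <= c0.
  apply: mulr_ge0 => //; do 3!apply: addr_ge0 => //.
  by apply: mulr_ge0 => //; exact: ltW.
have B_ge0 : 0 <= B.
  by apply: divr_ge0; [apply: addr_ge0 => //; exact: ltW | exact: ltW].
have bb_ge0 : 0 <= (b1 + b2 + 8) / xi.
  by apply: divr_ge0; [do 2!apply: addr_ge0 => // | exact: ltW].
pose L0 := 1 + 4 * u0 + (b1 + b2 + 8) / xi + c0 + B.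
exists ((2 * sg + 2 * (2 * ca) + 1) * A2); split.
  by apply: mulr_gt0 => //; clear -sg_ge0 ca_gt0; lra.
exists 8^-1, (expR (expR L0)); split; first by rewrite invr_gt0.
move=> N NL0 N2.
have [E NE] : exists E, N = expR E.
  by exists (ln N); rewrite lnK // posrE; clear -N2; lra.
have EL0 : expR L0 <= E by rewrite -ler_expR -NE.
have [L EL] : exists L, E = expR L.
  exists (ln E); rewrite lnK // posrE; apply: lt_le_trans EL0; exact: expR_gt0.
have L0L : L0 <= L by rewrite -ler_expR -EL.
have [L_ge1 L_u0 xiL L_cB] : [/\ 1 <= L, 4 * u0 <= L,
    b1 + b2 + 8 <= xi * L & c0 + B <= L].
  have bxi : (b1 + b2 + 8) / xi <= L.
    by apply: le_trans L0L; rewrite /L0; clear -bb_ge0 u0_ge0 c0_ge0 B_ge0; lra.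
  rewrite [xi * L]mulrC -ler_pdivrMr //.
  by move: L0L; rewrite /L0 => L0L; split => //;
    clear -bb_ge0 u0_ge0 c0_ge0 B_ge0 L0L; lra.
have L_ge0 : 0 <= L by clear -L_ge1; lra.
have LE : 1 + L <= expR L := expR_ge1Dx L.
have xiE : 8 <= xi * expR L.
  apply: (@le_trans _ _ (xi * L)); first by clear -xiL b1_ge0 b2_ge0; lra.
  by apply: ler_wpM2l; [exact: ltW | clear -LE; lra].
have powN r : N `^ r = expR (r * expR L) by rewrite NE EL mulrC expRM.
pose k := (Num.truncn (A1 * L)).+1.
have A1L_ge0 : 0 <= A1 * L by apply: mulr_ge0 => //; exact: ltW.
have k_ge : A1 * L <= k%:R by apply: ltW; rewrite /k -truncn_lt_nat.
have k_le : k%:R <= A2 * L.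
  have : (Num.truncn (A1 * L))%:R <= A1 * L by rewrite truncn_le.
  by rewrite /k /A2 -natr1; clear -L_ge1; lra.
pose v := u0 + k%:R * a.
have v_le : v <= L / 2.
  have ka : k%:R * a <= L / 4.
    apply: (@le_trans _ _ (A2 * L * a)); first by rewrite ler_pM2r.
    rewrite le_eqVlt; apply/orP; left; apply/eqP; rewrite /a; field.
    by rewrite gt_eqF.
  by rewrite /v; clear -ka L_u0; lra.
pose n := (Num.truncn (expR (expR v))).+1.
have xiL1 : 256 * A2 <= xi * L by move: xiL; rewrite /b1; clear -b2_ge0; lra.
have xiL2 : b2 <= xi * L by clear -xiL b1_ge0; lra.
have nk_le := block_bound_pow_le xipos L_ge0 xiL1 k_le v_le; rewrite -/n in nk_le.
pose Z := (Num.truncn (expR (xi / 4 * expR L))).+1.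
have Z_gt : expR (xi / 4 * expR L) <= Z%:R.
  by apply: ltW; rewrite /Z -truncn_lt_nat // expR_ge0.
have w_ge2 : 2 <= xi / 4 * expR L by clear -xiE; lra.
have w_ge1 : 1 <= xi / 4 * expR L by clear -xiE; lra.
(* Z <= N^(3 xi/8), which together with n^k <= N^(xi/8) just fits the level N^(xi/2). *)
have Z_le := truncnS_expR_le w_ge2; rewrite -/Z in Z_le.
have err := sieve_error_le xipos sg_ge0 L_ge1 xiL2 k_le.
set eps := `|K1| * _ in err.
have eps_ge0 : 0 <= eps by rewrite mulr_ge0 ?expR_ge0.
have nk_ge0 : 0 <= (n ^ k)%N%:R :> R by [].
have xiE0 : 0 <= xi * expR L by clear -xiE; lra.
have nknk_le : (n ^ k * n ^ k)%N%:R <= expR (xi / 2 * expR L).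
  rewrite natrM; apply: le_trans (ler_pM nk_ge0 nk_ge0 nk_le nk_le) _.
  by rewrite -expRD ler_expR; clear -xiE0; lra.
have nkZ_le : (n ^ k * Z)%N%:R <= expR (xi / 2 * expR L).
  rewrite natrM; apply: le_trans (ler_pM nk_ge0 (ler0n _ _) nk_le Z_le) _.
  by rewrite -expRD ler_expR; clear -xiE0; lra.
(* The factor 4 makes the loss from M a quarter of the main term; the summand 1 ensures m >= 1. The
   cutoff of this [psum] is exactly [Z]. *)
pose m := 4 * (psum eta_m (expR (xi / 4 * expR L)) + 1).
have psum_m_ge0 : 0 <= psum eta_m (expR (xi / 4 * expR L)).
  by apply: sumr_ge0 => p _; case: eta_m_mult => _ [_ /(_ p)/andP[]].
have m_le : m <= 4 * c_m * L + c0.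
  have := mertens_psum_le mert_m (ltW cmpos) xi4_gt0 w_ge1.
  by rewrite /m /c0; move: (psum _ _) => S; clear; lra.
have m_ge1 : 1 <= m by rewrite /m; clear -psum_m_ge0; lra.
pose Y (i : nat) := Num.truncn (expR (expR (u0 + i%:R * a))).
have Ymono i j : (i <= j)%N -> (Y i <= Y j)%N.
  move=> ij; apply: le_truncn; rewrite !ler_expR lerD2l.
  by rewrite ler_pM2r // ler_nat.
pose P (i : 'I_k) (p : 'I_n) := prime p && (Y i < p <= Y i.+1)%N.
have Pprime i p : P i p -> prime p by case/andP.
have Pdisj i j p : P i p -> P j p -> i = j.
  move=> /andP[_ /andP[ip pi]] /andP[_ /andP[jp pj]]; apply: val_inj => /=.
  have [ij|ji|//] := ltngtP i j.
    by have := leq_trans (leq_ltn_trans (Ymono _ _ ij) jp) pi; rewrite ltnn.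
  by have := leq_trans (leq_ltn_trans (Ymono _ _ ji) ip) pj; rewrite ltnn.
have S_bd i : expR (- sg) <= \sum_(p < n | P i p) eta_p p <= expR (2 * ca).
  apply: (@mertens_block_bounds _ eta_p c_p M_p K3 a
    (u0 + (i : nat)%:R * a) (u0 + i.+1%:R * a) n mert_p ca_gt0 (ltW a_gt0)).
  - by apply: addr_ge0 => //; apply: mulr_ge0 => //; exact: ltW.
  - by rewrite -natr1 mulrDl mul1r addrA.
  - apply: (@le_trans _ _ (ca * u0)).
      by rewrite /u0 [ca * _]mulrC divfK // gt_eqF.
    by rewrite ler_pM2l // lerDl; apply: mulr_ge0 => //; exact: ltW.
  - by rewrite ltnS; exact: (Ymono i.+1 k).
have cnt : (size (AN N))%:R * ((expR (- sg) ^+ k) ^+ 2 /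
     (4 * ((expR (2 * ca) * (1 + expR (2 * ca))) ^+ k + 1))) <=
   (count (fun x => (0 < \prod_i \sum_(p < n | P i p) (f p x == 1)%:R :> R) &&
                    (\sum_(p < Z | prime p) (f p x == -1)%:R < m)) (AN N))%:R.
  apply: (@sieve_transversal_count _ _ (AN N) f eta_m eta_p k n Z P eps
    (expR (xi / 2 * expR L))) => //.
  - move=> qm qp sm sp cop; rewrite -powN => /(equi N N2 qm qp sm sp cop).
    move=> /le_trans; apply; rewrite powN /eps mulNr.
    by apply: ler_wpM2r; [exact: expR_ge0 | exact: ler_norm].
  - exact: expR_gt0.
  - have -> : m / 4 = psum eta_m (expR (xi / 4 * expR L)) + 1.
      by rewrite /m mulrC mulKf.
    by rewrite lerDl.
  - by apply: le_trans err; apply: ler_wpM2r.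
  - apply: (@le_trans _ _ (expR (xi / 2 * expR L) * eps)); first exact: ler_wpM2r.
    (* The previous error bound suffices, as sig^k / 8 <= 1. *)
    apply: le_trans err _; rewrite -expRM_natr ler_pdivrMr // mul1r.
    apply: (@le_trans _ _ 1); last by rewrite ler1n.
    by rewrite -[leRHS]expR0 ler_expR mulNr oppr_le0; apply: mulr_ge0.
apply: (@le_trans _ _ ((size (AN N))%:R * ((expR (- sg) ^+ k) ^+ 2 /
     (4 * ((expR (2 * ca) * (1 + expR (2 * ca))) ^+ k + 1))))).
  rewrite [8^-1 * _]mulrC -[leLHS]mulrA; apply: ler_wpM2l => //.
  rewrite NE expRK EL; apply: density_ge => //.
  by apply: mulr_ge0 => //; exact: ltW.
apply: le_trans cnt _; rewrite ler_nat; apply: sub_in_count => x xN /andP[X0 Mm].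
apply/asboolP; apply: (fsum_ge_of_blocks _ Pprime Pdisj X0 (ltW Mm) (B := B)) => //.
  move=> n' Zn'; apply: large_support_le Zn' xi4_gt0 _ Z_gt.
    by have := supp N N2 x xN n'; rewrite powN.
  by clear -LE L_ge1; lra.
(* k - m - B >= (A1 - 4 c_m) L - c0 - B = A0 L + (L - c0 - B) >= A0 L. *)
rewrite NE expRK EL expRK; move: k_ge m_le L_cB; rewrite /A1.
by clear; lra.
Qed.
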